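(* Let $n\ge2$. The $n$-ary Cantor algebra $(\mathscr{T}_n,\alpha_1,\dots,\alpha_n,\lambda)$ is the free $n$-ary Cantor algebra on one generator.
   Context: An $n$-ary Cantor algebra is a structure $(X,\alpha_1,\dots,\alpha_n,\lambda)$, where the $\alpha_i$ are unary operations and $\lambda$ is an $n$-ary operation on $X$ (operations written to the right of their arguments), satisfying: (CA1) $(x\alpha_1,\dots,x\alpha_n)\lambda=x$ for all $x\in X$; (CA2) $(x_1,\dots,x_n)\lambda\alpha_i=x_i$ for all $x_1,\dots,x_n\in X$ and $1\le i\le n$. ''Free on one generator'' has its usual universal-algebraic meaning: there is an element $g$ such that for every $n$-ary Cantor algebra $C$ and every $x\in C$ there is a unique homomorphism of $n$-ary Cantor algebras to $C$ mapping $g$ to $x$. $A_n=\{a_1,\dots,a_n\}$, $n\geq 2$; $A_n^{*}$ is the free monoid, $A_n^{\omega}$ the Cantor space of right-infinite strings. A finite subset of $A_n^{*}$ is a prefix code if no element is a prefix of a different element; it is a maximal prefix code if moreover every string in $A_n^{*}$ is prefix comparable with (i.e. is a prefix of, or has as a prefix) some element of it. Given a prefix code $X=\{x_1,\dots,x_m\}$ and a list $Y=(y_1,\dots,y_m)$ of strings in $A_n^{*}$ (repetitions allowed), the symbol $\left(\frac{X}{Y}\right)$ determines the partial function on $A_n^{\omega}$ with domain $XA_n^{\omega}$ given by $x_iw\mapsto y_iw$ ($w\in A_n^{\omega}$). $\mathscr{C}_n$ is the monoid (under composition) of all partial functions on $A_n^{\omega}$ arising from symbols (equivalently the quotient of the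 monoid $M_n$ of surjective morphisms between finitely generated right ideals of $A_n^{*}$ by identifying elements inducing the same partial function on $A_n^{\omega}$). $\mathscr{T}_n$ is the submonoid of total maps, that is, those elements of $\mathscr{C}_n$ with domain all of $A_n^{\omega}$; these are the functions given by symbols $\left(\frac{X}{Y}\right)$ with $X$ a maximal prefix code. The operations are: for $a\in A_n$ let $\rho_a:A_n^{\omega}\to aA_n^{\omega}$, $w\mapsto aw$, with inverse $\rho_a^{-1}$; then $(f)\alpha_i=f\rho_{a_i}$ and $(f_1,\dots,f_n)\lambda=f_1\rho_{a_1}^{-1}\cup\dots\cup f_n\rho_{a_n}^{-1}$ (composition with the right-hand factor applied first). With these operations $\mathscr{T}_n$ is an $n$-ary Cantor algebra. *)

(* Defs.v *)
From mathcomp Require Import all_boot.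
From mathcomp Require Import boolp classical_sets.

Set Implicit Arguments.
Unset Strict Implicit.
Unset Printing Implicit Defensive.

Local Open Scope classical_set_scope.

Structure cantorAlgebra (n : nat) := CantorAlgebra {
  ca_sort :> Type;
  ca_alpha : 'I_n -> ca_sort -> ca_sort;
  ca_lambda : {ffun 'I_n -> ca_sort} -> ca_sort;
  ca_alphaK : forall x, ca_lambda [ffun i => ca_alpha i x] = x;
  ca_lambdaK : forall (xs : {ffun 'I_n -> ca_sort}) i,
    ca_alpha i (ca_lambda xs) = xs i
}.

Definition is_cantor_hom n (B C : cantorAlgebra n) (h : B -> C) : Prop :=
  (forall i x, h (ca_alpha i x) = ca_alpha i (h x)) /\
  (forall xs : {ffun 'I_n -> B},
     h (ca_lambda xs) = ca_lambda [ffun i => h (xs i)]).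

Definition free_on_one_generator n (F : cantorAlgebra n) : Prop :=
  exists g : F, forall (C : cantorAlgebra n) (x : C),
    exists! h : F -> C, is_cantor_hom h /\ h g = x.

(* The alphabet A_n is 'I_n: finite strings are [word n], right-infinite
   strings are [stream n]. *)
Definition word n := seq 'I_n.
Definition stream n := nat -> 'I_n.

Section Streams.
Variable n : nat.
Implicit Types (u x y : word n) (w : stream n) (a : 'I_n).

Definition scons a w : stream n := fun k => if k is k'.+1 then w k' else a.
Definition scat u w : stream n := foldr scons w u.
Definition stake m w : word n := mkseq w m.
Definition sdrop m w : stream n := fun k => w (m + k).
Definition sprefix x w : bool := x == stake (size x) w.

Definition prefix_code (X : seq (word n)) : Prop :=
  uniq X /\ {in X &, forall x y, prefix x y -> x = y}.

(* Partial functions on the Cantor space; [None] means "undefined". *)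
Definition pfun := stream n -> option (stream n).

Definition pcomp (f g : pfun) : pfun := fun w => obind f (g w).
Definition pempty : pfun := fun=> None.
(* The union of the graphs, for f and g agreeing on their common domain. *)
Definition punion (f g : pfun) : pfun := fun w => if f w is Some v then Some v else g w.

(* A symbol (X / Y) is the list of the pairs (x_i, y_i). When X is a prefix
   code, at most one pair is selected by the filter below. *)
Definition symbol_pfun (s : seq (word n * word n)) : pfun := fun w =>
  omap (fun p => scat p.2 (sdrop (size p.1) w))
       (ohead [seq p <- s | sprefix p.1 w]).

Definition Cn : set pfun :=
  [set f | exists2 s, prefix_code (unzip1 s) & f = symbol_pfun s].
Definition Tn : set pfun := [set f | Cn f /\ forall w, isSome (f w)].

Definition rho a : pfun := fun w => Some (scons a w).
Definition rhoV a : pfun := fun w => if w 0 == a then Some (sdrop 1 w) else None.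

Definition pfun_alpha a (f : pfun) : pfun := pcomp f (rho a).
Definition pfun_lambda (fs : 'I_n -> pfun) : pfun :=
  \big[punion/pempty]_(a < n) pcomp (fs a) (rhoV a).

Lemma size_stake m w : size (stake m w) = m.
Proof. exact: size_mkseq. Qed.

Lemma scons_sdrop w : scons (w 0) (sdrop 1 w) = w.
Proof. by apply: funext => -[|k]. Qed.

Lemma sdrop_scons a w : sdrop 1 (scons a w) = w.
Proof. exact: funext. Qed.

Lemma sdrop0 w : sdrop 0 w = w.
Proof. exact: funext. Qed.

Lemma sdropS m w : sdrop m.+1 w = sdrop m (sdrop 1 w).
Proof. by apply: funext => k; rewrite /sdrop add1n addSn. Qed.

Lemma stakeS m w : stake m.+1 w = w 0 :: stake m (sdrop 1 w).
Proof. by rewrite /stake /mkseq /= (iotaDl 1) -map_comp. Qed.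

Lemma scat_stake m w : scat (stake m w) (sdrop m w) = w.
Proof.
elim: m w => [|m IHm] w; first exact: sdrop0.
by rewrite stakeS sdropS /= IHm scons_sdrop.
Qed.

Lemma scat_cat x y w : scat (x ++ y) w = scat x (scat y w).
Proof. exact: foldr_cat. Qed.

Lemma stake_scat x w : stake (size x) (scat x w) = x.
Proof. by elim: x w => //= a x IHx w; rewrite stakeS sdrop_scons IHx. Qed.

Lemma sdrop_scat x w : sdrop (size x) (scat x w) = w.
Proof. by elim: x w => [|a x IHx] w /=; rewrite ?sdrop0 // sdropS sdrop_scons. Qed.

Lemma take_stake k m w : k <= m -> take k (stake m w) = stake k w.
Proof.
by move=> lekm; rewrite /stake /mkseq -map_take take_iota (minn_idPl lekm).
Qed.

Lemma scat_drop_stake k m w :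
  k <= m -> scat (drop k (stake m w)) (sdrop m w) = sdrop k w.
Proof.
move=> lekm; rewrite -[in RHS](scat_stake m w).
rewrite -[in RHS](cat_take_drop k (stake m w)) scat_cat take_stake //.
set w' := scat (drop _ _) _.
by have := sdrop_scat (stake k w) w'; rewrite size_stake => ->.
Qed.

Lemma sprefixP x w : reflect (exists w', w = scat x w') (sprefix x w).
Proof.
apply: (iffP eqP) => [xw|[w' ->]]; last by rewrite stake_scat.
by exists (sdrop (size x) w); rewrite {1}xw scat_stake.
Qed.

Lemma prefix_stake x m w :
  size x <= m -> prefix x (stake m w) = sprefix x w.
Proof. by move=> lexm; rewrite prefixE take_stake // eq_sym. Qed.

Lemma symbol_pfunE s x y w :
  prefix_code (unzip1 s) -> (x, y) \in s ->
  symbol_pfun s (scat x w) = Some (scat y w).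
Proof.
case=> uX pX s_xy; rewrite /symbol_pfun.
suff ->: [seq p <- s | sprefix p.1 (scat x w)] = [:: (x, y)].
  by rewrite /= sdrop_scat.
have Ep p : p \in s -> sprefix p.1 (scat x w) = (p.1 == x).
  move=> s_p; apply/idP/eqP => [px|->]; last by apply/sprefixP; exists w.
  have [X1 X2] : p.1 \in unzip1 s /\ x \in unzip1 s.
    by split; [apply: map_f | apply: (map_f fst s_xy)].
  have [le|/ltnW le] := leqP (size p.1) (size x).
    by apply: pX => //; rewrite -(stake_scat x w) prefix_stake.
  apply/esym/pX => //; rewrite (eqP px) prefix_stake //.
  by apply/sprefixP; exists w.
rewrite (eq_in_filter Ep); elim: s uX s_xy {pX Ep} => //= -[x1 y1] s IHs.
case/andP=> npX uX; rewrite inE => /predU1P[[Ex Ey]|s_xy] /=.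
  rewrite -Ex -Ey /= in npX *.
  rewrite eqxx; congr cons; apply: size0nil; apply/eqP.
  rewrite size_filter -leqn0 leqNgt -has_count.
  apply: contra npX => /hasP[q s_q /eqP Eq].
  by apply/mapP; exists q.
case: eqP npX => [/= ->|_ _]; last exact: IHs.
by case/negP; apply: (map_f fst s_xy).
Qed.

Lemma symbol_pfun_dom s w :
  isSome (symbol_pfun s w) <-> exists2 x, x \in unzip1 s & sprefix x w.
Proof.
rewrite /symbol_pfun; split=> [|[x /mapP[p s_p ->] pw]].
  case E: [seq p <- s | _] => [|p s'] //= _.
  have: p \in [seq p <- s | sprefix p.1 w] by rewrite E mem_head.
  by rewrite mem_filter => /andP[pw s_p]; exists p.1; rewrite ?map_f.
have: p \in [seq p <- s | sprefix p.1 w] by rewrite mem_filter pw.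
by case: [seq p <- s | _].
Qed.

Lemma TnP f :
  Tn f <-> exists m (v : word n -> word n),
             forall w, f w = Some (scat (v (stake m w)) (sdrop m w)).
Proof.
split=> [[[s pX ->] totf]|[m [v Ef]]].
  pose m := \max_(p <- s) size p.1.
  pose v u := if ohead [seq p <- s | prefix p.1 u] is Some p
              then p.2 ++ drop (size p.1) u else [::].
  have lem p : p \in s -> size p.1 <= m.
    by move=> s_p; apply: (leq_bigmax_seq (F := fun p => size p.1)).
  exists m, v => w; have := totf w; rewrite /symbol_pfun /v.
  rewrite (_ : [seq p <- s | sprefix _ _] = [seq p <- s | prefix p.1 (stake m w)]).
    case E: [seq p <- s | _] => [|p s'] //= _.
    have: p \in [seq p <- s | prefix p.1 (stake m w)] by rewrite E mem_head.
    rewrite mem_filter => /andP[_ s_p].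
    by rewrite scat_cat scat_drop_stake ?lem.
  by apply: eq_in_filter => p s_p; rewrite prefix_stake ?lem.
split=> [|w]; last by rewrite Ef.
pose s := [seq (val u, v (val u)) | u : m.-tuple 'I_n].
have pX : prefix_code (unzip1 s).
  have Es : unzip1 s = [seq val u | u : m.-tuple 'I_n].
    by rewrite /unzip1 /s -map_comp.
  rewrite Es; split; first by rewrite map_inj_uniq ?enum_uniq //; apply: val_inj.
  move=> _ _ /mapP[x _ ->] /mapP[y _ ->]; rewrite prefixE size_tuple.
  by rewrite -[in take _](size_tuple y) take_size => /eqP.
exists s => //; apply: funext => w; rewrite Ef.
have szw : size (stake m w) == m by rewrite size_stake.
rewrite -[in RHS](scat_stake m w) (symbol_pfunE (y := v (stake m w))) //.
by apply/mapP; exists (Tuple szw); rewrite ?mem_enum.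
Qed.

Lemma pfun_lambdaE fs w : pfun_lambda fs w = fs (w 0) (sdrop 1 w).
Proof.
rewrite /pfun_lambda.
have: w 0 \in index_enum 'I_n by rewrite mem_index_enum.
elim: (index_enum _) => // a r IHr; rewrite inE big_cons {1}/punion.
rewrite {1}/pcomp /rhoV; case: eqP => [<- _|_] /=; last exact: IHr.
case E: (fs (w 0) (sdrop 1 w)) => [v|] //.
by apply: (big_ind (fun g : pfun => g w = None)) => // [g h Eg Eh|b _];
  rewrite /punion ?Eg // /pcomp; case: eqP => [<-|].
Qed.

Lemma Tn_alpha a f : Tn f -> Tn (pfun_alpha a f).
Proof.
case/TnP=> m [v Ef]; apply/TnP.
exists m, (fun u => v (take m (a :: u)) ++ drop m (a :: u)) => w.
rewrite /pfun_alpha /pcomp /rho /= Ef scat_cat.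
have Ea : a :: stake m w = stake m.+1 (scons a w) by rewrite stakeS sdrop_scons.
rewrite Ea take_stake // -(scat_drop_stake (scons a w) (leqnSn m)).
by rewrite [sdrop m.+1 _]sdropS sdrop_scons.
Qed.

Lemma Tn_lambda fs : (forall a, Tn (fs a)) -> Tn (pfun_lambda fs).
Proof.
move=> Tfs; have /choice[mv Emv] a : exists mv : nat * (word n -> word n),
    forall w, fs a w = Some (scat (mv.2 (stake mv.1 w)) (sdrop mv.1 w)).
  by case/TnP: (Tfs a) => m [v]; exists (m, v).
pose M := \max_a (mv a).1; apply/TnP; exists M.+1.
exists (fun u => if u is a :: u' then
  (mv a).2 (take (mv a).1 u') ++ drop (mv a).1 u' else [::]) => w.
have leM a : (mv a).1 <= M by apply: (leq_bigmax a).
rewrite pfun_lambdaE Emv stakeS sdropS scat_cat.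
by rewrite take_stake // scat_drop_stake.
Qed.

Definition Tn_alpha_op a (f : Tn) : Tn :=
  SigSub (mem_set (Tn_alpha a (set_mem (valP f)))).

Definition Tn_lambda_op (fs : {ffun 'I_n -> Tn}) : Tn :=
  SigSub (mem_set (Tn_lambda (fun a => set_mem (valP (fs a))))).

Lemma Tn_alphaK f : Tn_lambda_op [ffun a => Tn_alpha_op a f] = f.
Proof.
apply: val_inj; apply: funext => w /=.
by rewrite pfun_lambdaE ffunE /= /pfun_alpha /pcomp /= scons_sdrop.
Qed.

Lemma Tn_lambdaK (fs : {ffun 'I_n -> Tn}) a :
  Tn_alpha_op a (Tn_lambda_op fs) = fs a.
Proof.
apply: val_inj; apply: funext => w /=.
by rewrite /pfun_alpha /pcomp /= pfun_lambdaE sdrop_scons.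
Qed.

Definition Tn_cantorAlgebra : cantorAlgebra n :=
  CantorAlgebra Tn_alphaK Tn_lambdaK.

End Streams.

(* Main.v *)
Require Import Defs.
From mathcomp Require Import all_boot.
From mathcomp Require Import boolp classical_sets.

(** The generator [g] is the identity of the Cantor space. Iterating the [alpha]
    along a word [t] sends [g] to the map [w |-> t w], and these maps are pairwise
    distinct because [n >= 2]. An element [f] of [T_n] acts on all words of some
    length [m] by prefix replacement, so the iterates of [f] along them are
    iterates of [g]. Any Cantor algebra generated in this way is free: the image
    of [f] is the element [y] such that [f u = g t] implies [y u = x t] for all
    words [u] and [t]. It exists by induction on [m] (glue with [lambda]), and it
    is unique because an element is determined by its iterates along the words of
    a fixed length. *)

Set Implicit Arguments.
Unset Strict Implicit.
Unset Printing Implicit Defensive.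

Definition ca_act n (C : cantorAlgebra n) (u : word n) (y : C) : C :=
  foldl (fun z a => ca_alpha a z) y u.

Section CantorAlgebra.
Variables (n : nat) (C : cantorAlgebra n).
Implicit Types (u v : word n) (y z : C).

Lemma ca_act_cons a u y : ca_act (a :: u) y = ca_act u (ca_alpha a y).
Proof. by []. Qed.

Lemma ca_act_rcons a u y : ca_act (rcons u a) y = ca_alpha a (ca_act u y).
Proof. by rewrite /ca_act foldl_rcons. Qed.

Lemma ca_alpha_inj y z : (forall a, ca_alpha a y = ca_alpha a z) -> y = z.
Proof.
move=> Eyz; rewrite -(ca_alphaK y) -(ca_alphaK z); congr ca_lambda.
by apply/ffunP => a; rewrite !ffunE.
Qed.

Lemma ca_act_inj m y z :
  (forall u, size u = m -> ca_act u y = ca_act u z) -> y = z.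
Proof.
elim: m y z => [|m IHm] y z Eyz; first exact: (Eyz [::]).
by apply: ca_alpha_inj => a; apply: IHm => u szu; apply: (Eyz (a :: u)); rewrite /= szu.
Qed.

Lemma hom_act (B : cantorAlgebra n) (h : C -> B) u y :
  is_cantor_hom h -> h (ca_act u y) = ca_act u (h y).
Proof.
by case=> h_alpha _; elim: u y => // a u IHu y; rewrite !ca_act_cons IHu h_alpha.
Qed.

End CantorAlgebra.

Section Freeness.
Variables (n : nat) (F : cantorAlgebra n) (g : F).

Hypothesis g_inj : injective (fun t => ca_act t g).
Hypothesis g_gen : forall f : F,
  exists m, forall u, size u = m -> exists t, ca_act u f = ca_act t g.

Section Extension.
Variables (C : cantorAlgebra n) (x : C).

Definition transports (f : F) (y : C) : Prop :=
  forall u t, ca_act u f = ca_act t g -> ca_act u y = ca_act t x.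

Lemma transports_gen : transports g x.
Proof. by move=> u t /g_inj ->. Qed.

Lemma transports_alpha a f y :
  transports f y -> transports (ca_alpha a f) (ca_alpha a y).
Proof. by move=> fy u; apply: (fy (a :: u)). Qed.

(** Only the empty word is new: the wanted equality [y = ca_act t x] is tested after each
    [ca_alpha a], which appends [a] to [t]. *)
Lemma transports_glue f y :
  (forall a, transports (ca_alpha a f) (ca_alpha a y)) -> transports f y.
Proof.
move=> fy [|a u] t; last exact: fy.
rewrite /= => Ef; apply: ca_alpha_inj => a.
by rewrite -ca_act_rcons; apply: (fy a [::]); rewrite ca_act_rcons -Ef.
Qed.

Lemma transports_ex f : exists y, transports f y.
Proof.
have [m] := g_gen f; elim: m f => [|m IHm] f f_m.
  have [t Ef] := f_m [::] erefl; exists (ca_act t x) => u t'.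
  (* Both sides of [E] are now iterates of [g], so injectivity forces [t' = t ++ u]. *)
  rewrite [f]Ef /ca_act -!foldl_cat => E; congr foldl.
  exact: g_inj.
have /choice[y fy] a : exists y, transports (ca_alpha a f) y.
  by apply: IHm => u szu; apply: (f_m (a :: u)); rewrite /= szu.
exists (ca_lambda [ffun a => y a]); apply: transports_glue => a.
by rewrite ca_lambdaK ffunE.
Qed.

Lemma transports_uniq f y z : transports f y -> transports f z -> y = z.
Proof.
move=> fy fz; have [m f_m] := g_gen f; apply: (@ca_act_inj _ _ m) => u szu.
by have [t Ef] := f_m u szu; rewrite (fy u t) ?(fz u t).
Qed.

Lemma hom_transports (h : F -> C) f :
  is_cantor_hom h -> h g = x -> transports f (h f).
Proof. by move=> hom_h hg u t Ef; rewrite -hom_act // Ef hom_act ?hg. Qed.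

End Extension.

Lemma free_on_generator : free_on_one_generator F.
Proof.
exists g => C x; have /choice[h hP] := transports_ex x.
exists h; split=> [|k [hom_k kg]].
  split; last exact: transports_uniq (hP g) (transports_gen x).
  (* In each homomorphism law both sides are transported from the same element of [F]. *)
  split=> [a f|fs]; apply: transports_uniq (hP _) _; first exact: transports_alpha.
  by apply: transports_glue => a; rewrite !ca_lambdaK ffunE.
apply: funext => f; apply: transports_uniq (hP f) _; exact: hom_transports.
Qed.

End Freeness.

(** With two letters available, a constant stream avoiding the first letter of a nonempty word
    separates that word from the empty one; equal first letters cancel. *)
Lemma scat_inj n : 2 <= n -> injective (@scat n).
Proof.
move=> n_ge2 u t Eut.
have other (b : 'I_n) : exists c, c != b.
  have: 0 < #|predC1 b| by rewrite cardC1 card_ord -subn1 subn_gt0.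
  by case/card_gt0P => c; exists c.
elim: u t Eut => [|a u IHu] [|b t] //= Eut.
- have [c /negP[]] := other b; apply/eqP.
  exact: (congr1 (fun F => F (fun=> c) 0) Eut).
- have [c /negP[]] := other a; apply/eqP; apply: esym.
  exact: (congr1 (fun F => F (fun=> c) 0) Eut).
have w0 : stream n := fun=> a.
have Ea : a = b := congr1 (fun F => F w0 0) Eut.
congr cons => //; apply: IHu; apply: funext => w.
by have := congr1 (fun F => sdrop 1 (F w)) Eut; rewrite /= !sdrop_scons.
Qed.

Section Tn.
Variable n : nat.

Lemma Tn_id : Tn (fun w : stream n => Some w).
Proof. by apply/TnP; exists 0, (fun=> [::]) => w; rewrite sdrop0. Qed.

Definition Tn_one : Tn_cantorAlgebra n := SigSub (mem_set Tn_id).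

(** Each [ca_alpha a] precomposes with prefixing by [a], so the last letter of [u] reaches [w] first
    and the prefix spells [u]. *)
Lemma Tn_actE u (f : Tn_cantorAlgebra n) w :
  val (ca_act u f) w = val f (scat u w).
Proof. by elim: u f => // a u IHu f; rewrite ca_act_cons IHu. Qed.

Lemma Tn_one_gen (f : Tn_cantorAlgebra n) :
  exists m, forall u, size u = m -> exists t, ca_act u f = ca_act t Tn_one.
Proof.
have /TnP[m [v Ef]] := set_mem (valP f).
(* On streams that begin with [u], [f] replaces this prefix by [v u]. *)
exists m => u szu; exists (v u); apply: val_inj; apply: funext => w.
by rewrite !Tn_actE Ef -szu stake_scat sdrop_scat.
Qed.

Lemma Tn_one_inj : 2 <= n -> injective (fun t => ca_act t Tn_one).
Proof.
move=> n_ge2 u t Eut; apply: scat_inj => //; apply: funext => w.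
by have := congr1 (fun f => val f w) Eut; rewrite /= !Tn_actE => -[].
Qed.

End Tn.

Theorem theorem5p23 (n : nat) (hn : 2 <= n) :
  free_on_one_generator (Tn_cantorAlgebra n).
Proof. exact: free_on_generator (Tn_one_inj hn) (@Tn_one_gen n). Qed.
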